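(* Let $\alpha \in (-\infty, 0)$. Then $$\sum_{n=1}^{\infty} n^\alpha |\nabla v_n|^2 \geq \frac{(\alpha-1)^2}{4} \sum_{n=1}^{\infty} (n+1)^{\alpha-2}v_n^2, \quad \text{for all } v\in C_c(\mathbb{N}) \text{ with } v_0=0,$$ or equivalently $$\sum_{n=2}^{\infty} (n-1)^\alpha |\nabla u_n|^2 \geq \frac{(\alpha-1)^2}{4} \sum_{n=2}^{\infty} n^{\alpha-2}u_n^2, \quad \text{for all } u\in C_c(\mathbb{N}) \text{ with } u_0=u_1=0.$$
   Context: $\mathbb{N}=\{0,1,2,\dots\}$, $C_c(\mathbb{N})$ is the space of finitely supported real sequences $u=(u_n)_{n\in\mathbb{N}}$, and $\nabla u_n = u_n-u_{n-1}$ for $n\geq 1$. *)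

(* Defs.v *)
From mathcomp Require Import all_boot all_order all_algebra.
From mathcomp Require Import all_classical all_reals all_analysis.

Set Implicit Arguments.
Unset Strict Implicit.
Unset Printing Implicit Defensive.

Import Order.TTheory GRing.Theory Num.Theory.

Local Open Scope classical_set_scope.
Local Open Scope ring_scope.

Definition Cc (R : realType) : set (nat -> R) :=
  [set u | finite_set [set n | u n != 0]].

(* Only used for n >= 1: at n = 0 the truncated predecessor gives 0. *)
Definition nabla (R : realType) (u : nat -> R) (n : nat) : R := u n - u n.-1.

(* Main.v *)
Require Import Defs.
From mathcomp Require Import all_boot all_order all_algebra.
From mathcomp Require Import all_classical all_reals all_analysis.
From mathcomp Require Import ring lra.

(** Write [beta = (1 - alpha) / 2]. The sequence [g n = (n + 1) `^ beta] is a
    positive supersolution: completing the square on each edge gives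
    [(x - y)^2 >= (1 - s) x^2 - (s^-1 - 1) y^2] with [s = g (n - 1) / g n], and
    summing by parts leaves the pointwise inequality between the resulting
    weights. With [t = 1 / (n + 1)] the latter becomes
    [(1-t)^(1-2 beta) - (1-t)^(1-beta) - (1+t)^beta + 1 >= beta^2 t^2], whose
    two sides agree to first order at [0], while the second derivative of the
    left one is at least [2 beta^2] for [0 <= t < 1]. *)

Set Implicit Arguments.
Unset Strict Implicit.
Unset Printing Implicit Defensive.

Import Order.TTheory GRing.Theory Num.Theory.

Local Open Scope ring_scope.

(** By the mean value theorem, [f t] is [t] times a value of [df]. Two successive uses pass from the
    sign of a second derivative to that of the function. *)
Lemma is_derive_ge0 (R : realType) (f df : R -> R) (t : R) :
  0 <= t -> f 0 = 0 ->
  (forall x, 0 <= x <= t -> is_derive x 1 f (df x)) ->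
  (forall x, 0 <= x <= t -> 0 <= df x) -> 0 <= f t.
Proof.
move=> t0 f0 fdf df0.
have fdf' x : x \in `]0, t[ -> is_derive x 1 f (df x).
  by move=> xt; apply: fdf; rewrite !(itvP xt).
have [|c ct] := MVT_segment t0 fdf'.
  apply: derivable_within_continuous => x; rewrite in_itv/= => xt.
  by case: (fdf _ xt).
rewrite f0 !subr0 => ->; apply: mulr_ge0 => //; apply: df0.
by rewrite !(itvP ct).
Qed.

Lemma is_derive_powR1B (R : realType) (a x : R) : x < 1 ->
  is_derive x 1 (fun y => (1 - y) `^ a) (- (a * (1 - x) `^ (a - 1))).
Proof.
move=> x1; have x0 : 0 < 1 - x by rewrite subr_gt0.
have D := is_derive1_powR a x0.
have D1 : is_derive x 1 (fun y : R => 1 - y) (-1).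
  by apply: is_derive_eq; ring.
have := @is_derive1_comp R (fun y => y `^ a) (fun y => 1 - y) _ _ _ D D1.
by rewrite mulrN1.
Qed.

Lemma is_derive_powR1D (R : realType) (a x : R) : 0 <= x ->
  is_derive x 1 (fun y => (1 + y) `^ a) (a * (1 + x) `^ (a - 1)).
Proof.
move=> x1; have x0 : 0 < 1 + x by rewrite ltr_wpDr.
have D := is_derive1_powR a x0.
have D1 : is_derive x 1 (fun y : R => 1 + y) 1.
  by apply: is_derive_eq; ring.
have := @is_derive1_comp R (fun y => y `^ a) (fun y => 1 + y) _ _ _ D D1.
by rewrite mulr1.
Qed.

Lemma powR1r (R : realType) (p : R) : 1 `^ p = 1.
Proof. by rewrite powR1. Qed.

(** This is the bound on the second derivative, divided by [b]. The sign of [b - 1] decides whether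
    the sum of powers it multiplies has to be bounded below or above. *)
Lemma supersolution_derive2_ge0 (R : realType) (b t : R) :
  2^-1 < b -> 0 <= t < 1 ->
  2 * b <= 2 * (2 * b - 1) * (1 - t) `^ (- 2 * b - 1)
    - (b - 1) * ((1 - t) `^ (- b - 1) + (1 + t) `^ (b - 2)).
Proof.
move=> b2 /andP[t0 t1].
have b2' : 1 < 2 * b by lra.
have y0 : 0 < 1 - t by lra.
have y1 : 0 < 1 - t <= 1 by rewrite y0; lra.
have ge1 a : a <= 0 -> 1 <= (1 - t) `^ a.
  by move=> a0; rewrite -[leLHS](powRr0 (1 - t)); apply: ger_powR.
have A1 : 1 <= (1 - t) `^ (- 2 * b - 1) by apply: ge1; lra.
have C1 : 1 <= (1 - t) `^ (- b - 1) by apply: ge1; lra.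
have AC : (1 - t) `^ (- b - 1) <= (1 - t) `^ (- 2 * b - 1).
  by apply: ger_powR => //; lra.
have inv_le : 1 + t <= (1 - t)^-1.
  by rewrite -[leRHS]mul1r ler_pdivlMr//; nra.
have powV a : (1 - t)^-1 `^ a = (1 - t) `^ (- a).
  by rewrite -powR_inv1 ?ltW// -powRrM mulN1r.
have [b1|b1] := leP b 1.
- have E1 : (1 - t) `^ (2 - b) <= (1 + t) `^ (b - 2).
    rewrite -(opprB 2 b) powRN -[leRHS]mul1r ler_pdivlMr; last first.
      by apply: powR_gt0; lra.
    rewrite -powRM; [|lra|lra].
    rewrite -[leRHS](powR1r (2 - b)).
    by apply: ge0_ler_powR; rewrite ?nnegrE; nra.
  have P1 : 1 <= (1 - t) `^ (- b - 1) * (1 - t) `^ (2 - b).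
    rewrite -powRD; first by apply: ge1; lra.
    by rewrite (lt0r_neq0 y0) implybT.
  (* AM-GM: two positive numbers with product at least 1 have sum at least 2. The bound then follows
     from [2 * (2 * b - 1) + 2 * (1 - b) = 2 * b]. *)
  have S2 : 2 <= (1 - t) `^ (- b - 1) + (1 - t) `^ (2 - b).
    have C0 := powR_gt0 (- b - 1) y0.
    rewrite -subr_ge0 -(pmulr_rge0 _ C0).
    by have := sqr_ge0 ((1 - t) `^ (- b - 1) - 1); lra.
  have : 0 <= (2 * b - 1) * ((1 - t) `^ (- 2 * b - 1) - 1).
    by rewrite mulr_ge0//; lra.
  have : 0 <= (1 - b) * ((1 - t) `^ (- b - 1) + (1 + t) `^ (b - 2) - 2).
    by rewrite mulr_ge0//; lra.
  lra.
- have E1 : (1 + t) `^ (b - 2) <= (1 - t) `^ (- b - 1).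
    apply: (@le_trans _ _ ((1 + t) `^ (b + 1))).
      by apply: ler_powR; lra.
    rewrite (_ : - b - 1 = - (b + 1)); last by ring.
    rewrite -powV; apply: ge0_ler_powR; rewrite ?nnegrE ?invr_ge0//; lra.
  have : 0 <= (2 * b - 1) * ((1 - t) `^ (- 2 * b - 1) - (1 - t) `^ (- b - 1)).
    by rewrite mulr_ge0//; lra.
  have : 0 <= (b - 1) * ((1 - t) `^ (- b - 1) - (1 + t) `^ (b - 2)).
    by rewrite mulr_ge0//; lra.
  have : 0 <= b * ((1 - t) `^ (- b - 1) - 1) by rewrite mulr_ge0//; lra.
  lra.
Qed.

Lemma supersolution_unit (R : realType) (b t : R) : 2^-1 < b -> 0 <= t < 1 ->
  b ^+ 2 * t ^+ 2 <=
  (1 - t) `^ (1 - 2 * b) - (1 - t) `^ (1 - b) - (1 + t) `^ b + 1.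
Proof.
move=> b2 /andP[t0 t1]; rewrite -subr_ge0.
pose d1 x := (2 * b - 1) * (1 - x) `^ (- 2 * b) - (b - 1) * (1 - x) `^ (- b)
  - b * (1 + x) `^ (b - 1) - 2 * b ^+ 2 * x.
apply: (@is_derive_ge0 R (fun t => (1 - t) `^ (1 - 2 * b) - (1 - t) `^ (1 - b)
   - (1 + t) `^ b + 1 - b ^+ 2 * t ^+ 2) d1 t t0).
- by rewrite !(subr0, addr0) !powR1; ring.
- move=> x /andP[x0 xt]; have x1 : x < 1 by lra.
  have D1 := is_derive_powR1B (1 - 2 * b) x1.
  have D2 := is_derive_powR1B (1 - b) x1.
  have D3 := is_derive_powR1D b x0.
  apply: is_derive_eq; rewrite /d1 /GRing.scale/=.
  rewrite (_ : 1 - 2 * b - 1 = - 2 * b); last by ring.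
  rewrite (_ : 1 - b - 1 = - b); last by ring.
  ring.
move=> s /andP[s0 st].
(* The derivative of [d1], with the factor [b] pulled out so that the remaining factor is the one
   already bounded. *)
pose d2 x := b * (2 * (2 * b - 1) * (1 - x) `^ (- 2 * b - 1)
    - (b - 1) * ((1 - x) `^ (- b - 1) + (1 + x) `^ (b - 2)) - 2 * b).
apply: (@is_derive_ge0 R d1 d2 s s0).
- by rewrite /d1 !(subr0, addr0) !powR1; ring.
- move=> x /andP[x0 xt]; have x1 : x < 1 by lra.
  have D1 := is_derive_powR1B (- 2 * b) x1.
  have D2 := is_derive_powR1B (- b) x1.
  have D3 := is_derive_powR1D (b - 1) x0.
  apply: is_derive_eq; rewrite /d2 /GRing.scale/=.
  rewrite (_ : b - 1 - 1 = b - 2); last by ring.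
  ring.
- move=> x /andP[x0 xs]; apply: mulr_ge0; first by lra.
  by rewrite subr_ge0; apply: supersolution_derive2_ge0 => //; lra.
Qed.

Definition ground_ratio (R : realType) (alpha : R) (n : nat) : R :=
  (n%:R / n.+1%:R) `^ ((1 - alpha) / 2).

Lemma ground_ratio_gt0 (R : realType) (alpha : R) n :
  (0 < n)%N -> 0 < ground_ratio alpha n.
Proof. by move=> n0; apply: powR_gt0; rewrite divr_gt0 ?ltr0n. Qed.

Lemma supersolution_nat (R : realType) (alpha : R) n :
  alpha < 0 -> (0 < n)%N ->
  (alpha - 1) ^+ 2 / 4 * n.+1%:R `^ (alpha - 2) <=
  n%:R `^ alpha * (1 - ground_ratio alpha n)
    - n.+1%:R `^ alpha * ((ground_ratio alpha n.+1)^-1 - 1).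
Proof.
move=> alpha_lt0 n0; pose b := (1 - alpha) / 2.
have m0 : (0 : R) < n.+1%:R by rewrite ltr0n.
pose t : R := n.+1%:R^-1.
have t0 : 0 < t by rewrite invr_gt0.
have t1 : t < 1 by rewrite invf_lt1// ltr1n.
have y0 : 0 < 1 - t by lra.
have b2 : 2^-1 < b by rewrite /b; lra.
have nE : n%:R = n.+1%:R * (1 - t) :> R.
  by rewrite mulrBr mulfV ?gt_eqF// mulr1 -natr1 addrK.
have r1 : ground_ratio alpha n = (1 - t) `^ b.
  by rewrite /ground_ratio {1}nE mulrAC mulfV ?gt_eqF// mul1r.
have r2 : (ground_ratio alpha n.+1)^-1 = (1 + t) `^ b.
  have n2E : n.+2%:R = n.+1%:R * (1 + t) :> R.
    by rewrite mulrDr mulfV ?gt_eqF// mulr1 natr1.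
  rewrite /ground_ratio -powR_inv1 ?powR_ge0// powRAC powR_inv1 ?divr_ge0//.
  by rewrite invf_div n2E mulrAC mulfV ?gt_eqF// mul1r.
have alphaE : alpha = 1 - 2 * b by rewrite /b; field.
have aE : n%:R `^ alpha = n.+1%:R `^ alpha * (1 - t) `^ (1 - 2 * b).
  by rewrite nE powRM ?ltW// -alphaE.
have wE : n.+1%:R `^ (alpha - 2) = n.+1%:R `^ alpha * t ^+ 2.
  by rewrite powRB ?(lt0r_neq0 m0) ?implybT// powR_mulrn ?ltW// /t exprVn.
have bE : (alpha - 1) ^+ 2 / 4 = b ^+ 2 by rewrite /b; field.
have prodE : (1 - t) `^ (1 - 2 * b) * (1 - t) `^ b = (1 - t) `^ (1 - b).
  rewrite -powRD ?(lt0r_neq0 y0) ?implybT//; congr (_ `^ _); ring.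
rewrite r1 r2 aE wE bE.
have t01 : 0 <= t < 1 by rewrite ltW.
have H := supersolution_unit b2 t01.
have := ler_wpM2l (powR_ge0 n.+1%:R alpha) H.
rewrite -prodE; set p := _ `^ alpha; set q := _ `^ (1 - _).
set r := (1 - t) `^ b; set s := (1 + t) `^ b.
lra.
Qed.

(** The difference of the two sides is [(s * x - y) ^+ 2 / s], which vanishes when [y = s * x], as
    for consecutive values of [g]. *)
Lemma sqrB_ge_weighted (R : realFieldType) (s x y : R) : 0 < s ->
  (1 - s) * x ^+ 2 - (s^-1 - 1) * y ^+ 2 <= (x - y) ^+ 2.
Proof.
move=> s0; rewrite -subr_ge0.
rewrite (_ : _ - _ = (s * x - y) ^+ 2 / s); last by field; rewrite gt_eqF.
by rewrite divr_ge0 ?sqr_ge0// ltW.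
Qed.

Lemma hardy_partial_sum (R : realType) (alpha : R) (v : nat -> R) (N : nat) :
  alpha < 0 -> v 0%N = 0 ->
  (alpha - 1) ^+ 2 / 4 *
    \sum_(1 <= n < N.+1) n.+1%:R `^ (alpha - 2) * v n ^+ 2
  <= \sum_(1 <= n < N.+1) n%:R `^ alpha * `|nabla v n| ^+ 2.
Proof.
move=> alpha_lt0 v0.
(* [Q N * v N ^+ 2] is the boundary term of the summation by parts at [N]. It is nonnegative because
   [ground_ratio] is at most 1, so adding it to the left side strengthens the claim enough for
   induction. *)
pose Q n : R := n.+1%:R `^ alpha * ((ground_ratio alpha n.+1)^-1 - 1).
have Q_ge0 n : 0 <= Q n.
  apply: mulr_ge0; first exact: powR_ge0.
  rewrite subr_ge0 invf_ge1 ?ground_ratio_gt0// /ground_ratio.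
  rewrite -[leRHS](powR1r ((1 - alpha) / 2)).
  apply: ge0_ler_powR; rewrite ?nnegrE ?divr_ge0//.
    by lra.
  by rewrite ler_pdivrMr ?ltr0n// mul1r ler_nat.
suff: (alpha - 1) ^+ 2 / 4 *
    \sum_(1 <= n < N.+1) n.+1%:R `^ (alpha - 2) * v n ^+ 2 + Q N * v N ^+ 2
  <= \sum_(1 <= n < N.+1) n%:R `^ alpha * `|nabla v n| ^+ 2.
  by apply: le_trans; rewrite lerDl mulr_ge0 ?sqr_ge0.
elim: N => [|N IH]; first by rewrite !big_geq// v0 mulr0 expr0n mulr0 addr0.
rewrite big_nat_recr//= [leRHS]big_nat_recr//= real_normK ?num_real//.
(* In the completed square [E] the new edge absorbs [Q N * v N ^+ 2]; by [W] what is left covers the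
   new summand and [Q N.+1 * v N.+1 ^+ 2]. *)
have W := @supersolution_nat R alpha N.+1 alpha_lt0 isT.
have E := ler_wpM2l (powR_ge0 N.+1%:R alpha)
  (@sqrB_ge_weighted R _ (v N.+1) (v N)
     (ground_ratio_gt0 alpha (isT : 0 < N.+1)%N)).
have {}W := ler_wpM2r (sqr_ge0 (v N.+1)) W.
rewrite /nabla/=; move: IH W E; rewrite /Q.
set c := (alpha - 1) ^+ 2 / 4; set S := \sum_(_ <= _ < _) _.
set S' := \sum_(_ <= _ < _) _; lra.
Qed.

(** Series of nonnegative terms converge in the extended reals, so the inequality passes to the
    limit from the partial sums. *)
Lemma lee_nneseriesZ (R : realType) (c : R) (f g : nat -> R) (m : nat) :
  0 <= c -> (forall n, 0 <= f n) -> (forall n, 0 <= g n) ->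
  (forall N, c * \sum_(m <= n < N + m) f n <= \sum_(m <= n < N + m) g n) ->
  (c%:E * \sum_(m <= n <oo) (f n)%:E <= \sum_(m <= n <oo) (g n)%:E)%E.
Proof.
move=> c0 f0 g0 fg.
rewrite -nneseriesZl; last by move=> n _; rewrite lee_fin.
apply: lee_lim.
- by apply: is_cvg_nneseries => n _ _; rewrite lee_fin mulr_ge0.
- by apply: is_cvg_nneseries => n _ _; rewrite lee_fin.
exists m => // N /= mN.
under eq_bigr do rewrite -EFinM.
by rewrite !sumEFin lee_fin -mulr_sumr -(subnK mN).
Qed.

Theorem theorem1p2 (R : realType) (alpha : R) (halpha : alpha < 0) :
  (forall v : nat -> R, Cc v -> v 0%N = 0 ->
    (((alpha - 1) ^+ 2 / 4)%:E *
       \sum_(1 <= n <oo) ((n.+1%:R `^ (alpha - 2)) * v n ^+ 2)%:E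
     <= \sum_(1 <= n <oo) ((n%:R `^ alpha) * `|nabla v n| ^+ 2)%:E)%E)
  /\
  (forall u : nat -> R, Cc u -> u 0%N = 0 -> u 1%N = 0 ->
    (((alpha - 1) ^+ 2 / 4)%:E *
       \sum_(2 <= n <oo) ((n%:R `^ (alpha - 2)) * u n ^+ 2)%:E
     <= \sum_(2 <= n <oo) ((n.-1%:R `^ alpha) * `|nabla u n| ^+ 2)%:E)%E).
Proof.
have c0 : 0 <= (alpha - 1) ^+ 2 / 4 by rewrite divr_ge0 ?sqr_ge0.
split=> [v _ v0|u _ _ u1]; apply: lee_nneseriesZ => //.
- by move=> n; rewrite mulr_ge0 ?powR_ge0 ?sqr_ge0.
- by move=> N; rewrite addn1; exact: hardy_partial_sum.
- by move=> n; rewrite mulr_ge0 ?powR_ge0 ?sqr_ge0.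
(* The second form is the first one for the shifted sequence [u k.+1], whose value at 0 is
   [u 1 = 0]. The gradients agree since the sum starts at [n = 1], where the predecessor is not
   truncated. *)
move=> N; rewrite addn2 big_add1 [leRHS]big_add1/=.
rewrite [leRHS](_ : _ = \sum_(1 <= n < N.+1)
    n%:R `^ alpha * `|nabla (fun k => u k.+1) n| ^+ 2).
  exact: (@hardy_partial_sum R alpha (fun k => u k.+1)).
by apply: eq_big_nat => n /andP[n0 _]; rewrite /nabla/= prednK.
Qed.
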